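(* Let $R$ be a ring. The following statements are equivalent: (1) $\overline{\mathbb{P}}_\sigma=\mathbb{S}_\sigma$ for every preradical $\sigma$ on $R\text{-Mod}$. (2) $R$ is a semisimple ring.
   Context: $R$ is an associative ring with identity; modules are left $R$-modules. A preradical on $R\text{-Mod}$ is a functor $\sigma:R\text{-Mod}\to R\text{-Mod}$ with $\sigma(M)\le M$ for all $M$ and $f(\sigma(M))\le\sigma(N)$ for every homomorphism $f:M\to N$ ($\sigma(f)$ being the restriction of $f$). $\mathbb{T}_\sigma=\{M\mid\sigma(M)=M\}$. $\overline{\mathbb{P}}_\sigma$ is the class consisting of the zero module and all nonzero modules $M$ that are $\sigma$-co-first, i.e. either $M\in\mathbb{T}_\sigma$ or $M$ has no nonzero quotient in $\mathbb{T}_\sigma$. $\mathbb{S}_\sigma$ is the class consisting of the zero module and all nonzero modules $M$ that are $\sigma$-second, i.e. $\sigma(M)=0$ or $\sigma(M)=M$. *)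

(* Defs.v *)
From HB Require Import structures.
From mathcomp Require Import all_boot all_algebra generic_quotient ring_quotient.

Set Implicit Arguments.
Unset Strict Implicit.
Unset Printing Implicit Defensive.

Import GRing.Theory.
Local Open Scope ring_scope.
Local Open Scope quotient_scope.

(* A submodule of M is a [submodClosed M], i.e. a boolean predicate closed    *)
(* under the module operations.  With the classical axioms of                 *)
(* mathcomp.classical.boolp this is no restriction: every Prop-valued         *)
(* predicate is (extensionally) a boolean one.                                *)

Section QuotientModule.
Variables (R : pzRingType) (M : lmodType R) (K : submodClosed M).

(* The library does not derive the [zmodClosed] structure of a submodule,     *)
(* which the quotient of the underlying additive groups requires.             *)
Definition quotmod_pred : {pred M} := fun x => x \in K.

Lemma quotmod_pred_closed : zmod_closed quotmod_pred.
Proof. exact: GRing.submod_closedB (submodClosedP K). Qed.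

HB.instance Definition _ :=
  GRing.isZmodClosed.Build M quotmod_pred quotmod_pred_closed.

Definition quotmod : Type := Quotient.quot quotmod_pred.

HB.instance Definition _ := GRing.Zmodule.on quotmod.
HB.instance Definition _ := EqQuotient.on quotmod.

Definition quotmod_scale (a : R) (q : quotmod) : quotmod :=
  \pi_quotmod (a *: repr q).

Lemma quotmod_pi_eq (x y : M) :
  (\pi_quotmod x == \pi_quotmod y) = (x - y \in K).
Proof. exact: esym (Quotient.idealrBE quotmod_pred x y). Qed.

Lemma quotmod_piD (x y : M) :
  \pi_quotmod (x + y) = \pi_quotmod x + \pi_quotmod y.
Proof. exact: (Quotient.pi_add quotmod_pred). Qed.

Lemma quotmod_piZ (a : R) (x : M) :
  \pi_quotmod (a *: x) = quotmod_scale a (\pi_quotmod x).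
Proof.
apply/eqP; rewrite quotmod_pi_eq -scalerBr.
by apply: rpredZ; rewrite -quotmod_pi_eq reprK.
Qed.

Lemma quotmod_scalerA a b q :
  quotmod_scale a (quotmod_scale b q) = quotmod_scale (a * b) q.
Proof. by rewrite -[q]reprK -(quotmod_piZ b) -!quotmod_piZ scalerA. Qed.

Lemma quotmod_scale1r : left_id 1 quotmod_scale.
Proof. by move=> q; rewrite -[q]reprK -quotmod_piZ scale1r. Qed.

Lemma quotmod_scalerDr : right_distributive quotmod_scale +%R.
Proof.
move=> a p q; rewrite -[p]reprK -[q]reprK -quotmod_piD -!quotmod_piZ.
by rewrite scalerDr quotmod_piD.
Qed.

Lemma quotmod_scalerDl q : {morph quotmod_scale^~ q : a b / a + b}.
Proof.
by move=> a b; rewrite -[q]reprK -!quotmod_piZ scalerDl quotmod_piD.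
Qed.

HB.instance Definition _ := GRing.Zmodule_isLmodule.Build R quotmod
  quotmod_scalerA quotmod_scale1r quotmod_scalerDr quotmod_scalerDl.

Lemma quotmod_pi_is_linear : linear (\pi_quotmod : M -> quotmod).
Proof. by move=> a x y; rewrite quotmod_piD quotmod_piZ. Qed.

HB.instance Definition _ :=
  GRing.isLinear.Build R M quotmod *:%R \pi_quotmod quotmod_pi_is_linear.

End QuotientModule.

Definition zero_module (R : pzRingType) (M : lmodType R) : Prop :=
  forall x : M, x = 0.

(* The action of the functor on morphisms, being restriction, is determined   *)
(* by the action on objects, and the functor laws hold automatically.         *)
Record preradical (R : pzRingType) : Type := Preradical {
  prerad_sub :> forall M : lmodType R, submodClosed M;
  prerad_hom : forall (M N : lmodType R) (f : {linear M -> N}) (x : M),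
    x \in prerad_sub M -> f x \in prerad_sub N
}.

Section Classes.
Variables (R : pzRingType) (sigma : preradical R).

Definition torsion_class (M : lmodType R) : Prop :=
  forall x : M, x \in sigma M.

Definition cofirst (M : lmodType R) : Prop :=
  torsion_class M \/
  ~ exists K : submodClosed M,
      ~ zero_module (quotmod K) /\ torsion_class (quotmod K).

Definition second (M : lmodType R) : Prop :=
  (forall x : M, x \in sigma M -> x = 0) \/ (forall x : M, x \in sigma M).

Definition cofirst_class (M : lmodType R) : Prop :=
  zero_module M \/ (~ zero_module M /\ cofirst M).

Definition second_class (M : lmodType R) : Prop :=
  zero_module M \/ (~ zero_module M /\ second M).

End Classes.

Definition simple_submod (R : pzRingType) (M : lmodType R)
    (S : submodClosed M) : Prop :=
  (exists2 x : M, x \in S & x != 0) /\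
  forall K : submodClosed M, {subset K <= S} ->
    (forall x : M, x \in K -> x = 0) \/ {subset S <= K}.

Definition internal_direct_sum (R : pzRingType) (M : lmodType R)
    (I : eqType) (S : I -> submodClosed M) : Prop :=
  (forall x : M, exists (s : seq I) (u : I -> M),
     (forall i, u i \in S i) /\ x = \sum_(i <- s) u i) /\
  (forall (s : seq I) (u : I -> M), uniq s -> (forall i, u i \in S i) ->
     \sum_(i <- s) u i = 0 -> forall i, i \in s -> u i = 0).

Definition semisimple_module (R : pzRingType) (M : lmodType R) : Prop :=
  exists (I : eqType) (S : I -> submodClosed M),
    (forall i, simple_submod (S i)) /\ internal_direct_sum S.

Definition semisimple_ring (R : pzRingType) : Prop :=
  semisimple_module (R^o : lmodType R).

(* Main.v *)
Require Import Defs.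
From mathcomp Require Import all_boot all_algebra.
From HB Require Import structures.
From mathcomp Require Import boolp classical_sets.
From mathcomp Require Import generic_quotient.

Set Implicit Arguments.
Unset Strict Implicit.
Unset Printing Implicit Defensive.

Import GRing.Theory.
Local Open Scope ring_scope.
Local Open Scope quotient_scope.

(** Over a semisimple ring every submodule K of a module M has a complement
    (a submodule L maximal with L meeting K trivially).  This makes the two
    classes agree.  If sigma(M) = 0, the projection M -> M/K splits, and the
    splitting sends sigma(M/K) into sigma(M) = 0, so a torsion quotient M/K
    vanishes.  If sigma(M) <> 0 and L is a complement of sigma(M), then M/L is
    the image of sigma(M), hence torsion, and it is nonzero.

    Conversely, it is enough to test the hypothesis on M = R with two kinds of
    preradicals, each sending M to the submodule spanned by a family of
    elements that homomorphisms preserve ([span_preradical]).  Let m be a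
    maximal left ideal.
    - The elements killed by m ([ex_annihilated]): R/m is a torsion quotient of
      R, so R cannot be sigma-torsion-free; hence m a = 0 for some a <> 0.
    - The multiples a y ([ex_maximal_not_containing]), giving sigma(M) = RaM:
      if aR were contained in every maximal left ideal, then (as in Nakayama's
      lemma) no nonzero quotient of R would be torsion, so R would be
      co-first, hence second, which fails since a is in sigma(R) and sigma(R)
      lies in a maximal left ideal.

    So some b = ar avoids a maximal left ideal K, and m b = 0.  As Rb is
    isomorphic to R/m, it is a complement of K, so it is generated by an
    idempotent x b; then b x is not in m and R b x is a simple left ideal
    outside m ([simple_not_in_maximal]).  Hence no maximal left ideal contains
    the socle, the socle is R, and 1 lies in a sum of finitely many simple left
    ideals; a sum of this kind with the fewest terms is direct
    ([classes_agree_semisimple]). *)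

(** * Submodules given by propositions, spans and quotients *)

Section Submodules.
Variable R : pzRingType.
Implicit Types M N : lmodType R.

Lemma asbool_submod_closed M (P : M -> Prop) :
    P 0 -> (forall a x y, P x -> P y -> P (a *: x + y)) ->
  submod_closed (fun x => `[< P x >]).
Proof.
move=> P0 PL; split; first exact/asboolP.
by move=> a x y /asboolP Px /asboolP Py; apply/asboolP/PL.
Qed.

Definition submod_of M (P : M -> Prop) (P0 : P 0)
    (PL : forall a x y, P x -> P y -> P (a *: x + y)) : submodClosed M :=
  HB.pack (fun x : M => `[< P x >])
    (GRing.isSubmodClosed.Build R M _ (asbool_submod_closed P0 PL)).

Lemma submod_ofP M (P : M -> Prop) P0 PL x :
  reflect (P x) (x \in @submod_of M P P0 PL).
Proof. exact: asboolP. Qed.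

Lemma submod_linear M (K : submodClosed M) a x y :
  x \in K -> y \in K -> a *: x + y \in K.
Proof. by move=> Kx Ky; rewrite rpredD ?rpredZ. Qed.

Lemma submodB M (K : submodClosed M) x y : x \in K -> y \in K -> x - y \in K.
Proof. by have [_ subK] := GRing.submod_closedB (submodClosedP K); apply: subK. Qed.

Lemma zero_linear M a (x y : M) : x = 0 -> y = 0 -> a *: x + y = 0.
Proof. by move=> -> ->; rewrite scaler0 addr0. Qed.

Definition zero_submod M : submodClosed M :=
  submod_of (erefl (0 : M)) (@zero_linear M).

Lemma zero_submodP M (x : M) : reflect (x = 0) (x \in zero_submod M).
Proof. exact: submod_ofP. Qed.

Lemma preim_linear M N (f : {linear M -> N}) (K : submodClosed N) a x y :
  f x \in K -> f y \in K -> f (a *: x + y) \in K.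
Proof. by move=> Kx Ky; rewrite linearP submod_linear. Qed.

Lemma preim0 M N (f : {linear M -> N}) (K : submodClosed N) : f 0 \in K.
Proof. by rewrite linear0 rpred0. Qed.

Definition preim_submod M N (f : {linear M -> N}) (K : submodClosed N) :
    submodClosed M :=
  @submod_of M (fun x => f x \in K) (preim0 f K) (@preim_linear M N f K).

(** An impredicative description, which makes no use of finite linear
    combinations: this is what makes functoriality immediate. *)
Definition in_span M (A : M -> Prop) x :=
  forall K : submodClosed M, (forall y, A y -> y \in K) -> x \in K.

Lemma in_span0 M (A : M -> Prop) : in_span A 0.
Proof. by move=> K _; exact: rpred0. Qed.

Lemma in_span_linear M (A : M -> Prop) a x y :
  in_span A x -> in_span A y -> in_span A (a *: x + y).
Proof. by move=> Ax Ay K AK; rewrite submod_linear ?Ax ?Ay. Qed.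

Definition span M (A : M -> Prop) : submodClosed M :=
  submod_of (@in_span0 M A) (@in_span_linear M A).

Lemma span_sub M (A : M -> Prop) (K : submodClosed M) :
  (forall y, A y -> y \in K) -> {subset span A <= K}.
Proof. by move=> AK x /submod_ofP; apply. Qed.

Lemma mem_span M (A : M -> Prop) x : A x -> x \in span A.
Proof. by move=> Ax; apply/submod_ofP => K; apply. Qed.

(** The preimage of span (A N) under f is a submodule that contains A M. *)
Lemma span_hom (A : forall M, M -> Prop)
    (A_hom : forall M N (f : {linear M -> N}) x, A M x -> A N (f x))
    M N (f : {linear M -> N}) x :
  x \in span (A M) -> f x \in span (A N).
Proof.
move=> Ax; suff /submod_ofP : x \in preim_submod f (span (A N)) by [].
apply: span_sub Ax => y Ay.
by apply/submod_ofP; exact/mem_span/A_hom.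
Qed.

Definition span_preradical (A : forall M, M -> Prop)
    (A_hom : forall M N (f : {linear M -> N}) x, A M x -> A N (f x)) :
    preradical R :=
  Preradical (prerad_sub := fun M => span (A M)) (span_hom A_hom).

Lemma pi_eq0 M (K : submodClosed M) x :
  (\pi_(quotmod K) x == 0) = (x \in K).
Proof. by rewrite -(linear0 \pi_(quotmod K)) quotmod_pi_eq subr0. Qed.

Lemma pi_scale M (K : submodClosed M) a x :
  \pi_(quotmod K) (a *: x) = a *: \pi_(quotmod K) x.
Proof. exact: linearZ. Qed.

Lemma zero_quotP M (K : submodClosed M) :
  zero_module (quotmod K) <-> forall x, x \in K.
Proof.
split=> [q0 x|allK q]; first by rewrite -pi_eq0 [X in X == _]q0.
by rewrite -[q]reprK; apply/eqP; rewrite pi_eq0.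
Qed.

(** Zorn's lemma for submodules of M avoiding A.  Maximality of L is applied to
    the submodules Rx + L, which must meet A when x is not in L.  With
    A = {1} this gives maximal left ideals, with A = K \ {0} complements of K. *)
Lemma ex_maximal_disjoint M (A : M -> Prop) (K : submodClosed M) :
    (forall x, x \in K -> ~ A x) ->
  exists L : submodClosed M,
    [/\ {subset K <= L}, forall x, x \in L -> ~ A x &
        forall x, x \notin L -> exists a y, y \in L /\ A (a *: x + y)].
Proof.
move=> KA.
pose T := {L : submodClosed M | {subset K <= L} /\ forall x, x \in L -> ~ A x}.
pose le (s t : T) := `[< {subset sval s <= sval t} >].
pose t0 : T := exist _ K (conj (fun x => id) KA).
have [||F Ftot|t tmax] := @ZL_preorder T t0 le.
- by move=> s; apply/asboolP.
- by move=> r s t /asboolP rs /asboolP st; apply/asboolP => x /rs /st.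
- have [[s0 Fs0]|noF] := pselect (exists s, F s); last first.
    by exists t0 => s Fs; case: noF; exists s.
  pose U x := exists2 s, F s & x \in sval s.
  have U0 : U 0 by exists s0; rewrite ?rpred0.
  have UL a x y : U x -> U y -> U (a *: x + y).
    move=> [s Fs sx] [t Ft ty].
    have [/asboolP st|/asboolP ts] := Ftot _ _ Fs Ft.
      by exists t => //; apply: submod_linear => //; apply: st.
    by exists s => //; apply: submod_linear => //; apply: ts.
  have UP : {subset K <= submod_of U0 UL} /\
      forall x, x \in submod_of U0 UL -> ~ A x.
    split=> x.
      by move=> Kx; apply/submod_ofP; exists s0 => //; case: (svalP s0) => + _; apply.
    by move=> /submod_ofP[s Fs sx]; case: (svalP s) => _; apply.
  exists (exist _ (submod_of U0 UL) UP) => s Fs; apply/asboolP => x sx.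
  by apply/submod_ofP; exists s.
case: t tmax => L [KL LA] Lmax; exists L; split=> // x Lx.
apply: contrapT => noA.
(* The submodule Rx + L, which strictly contains L. *)
pose Q z := exists a y, y \in L /\ z = a *: x + y.
have Q0 : Q 0 by exists 0, 0; rewrite rpred0 scale0r addr0.
have QL b z z' : Q z -> Q z' -> Q (b *: z + z').
  move=> [a [y [Ly ->]]] [a' [y' [Ly' ->]]].
  exists (b * a + a'), (b *: y + y'); split; first exact: submod_linear.
  by rewrite scalerDr scalerA scalerDl !addrA; congr (_ + _); rewrite addrAC.
have QP : {subset K <= submod_of Q0 QL} /\
    forall x, x \in submod_of Q0 QL -> ~ A x.
  split=> z.
    by move=> /KL Lz; apply/submod_ofP; exists 0, z; rewrite scale0r add0r.
  by move=> /submod_ofP[a [y [Ly ->]]] Az; apply: noA; exists a, y.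
have LQ : le (exist _ L (conj KL LA)) (exist _ (submod_of Q0 QL) QP).
  by apply/asboolP => z Lz; apply/submod_ofP; exists 0, z; rewrite scale0r add0r.
have /negP := Lx; apply; have /asboolP := Lmax _ LQ; apply.
by apply/submod_ofP; exists 1, 0; rewrite rpred0 scale1r addr0.
Qed.

End Submodules.

(** * Maximal and simple left ideals *)

Section MaximalIdeals.
Variable R : pzRingType.
Notation ideal := (submodClosed (R^o : lmodType R)).

(** The second clause says R c + m = R for every c outside m, the only form in
    which maximality is used. *)
Definition maximal_ideal (m : ideal) :=
  (1 : R^o) \notin m /\
  forall c : R^o, c \notin m -> exists y n : R^o, n \in m /\ 1 = y * c + n.

Lemma ex_maximal_ideal (K : ideal) :
  (1 : R^o) \notin K -> exists2 m : ideal, maximal_ideal m & {subset K <= m}.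
Proof.
move=> K1.
have [x + xE|m [Km m1 mmax]] := @ex_maximal_disjoint R R^o (fun x => 1 = x) K.
  by rewrite -xE; exact/negP.
exists m => //; split; first by apply/negP => /m1.
by move=> c /mmax[y [n [mn ->]]]; exists y, n.
Qed.

Lemma idealM (K : ideal) (a x : R^o) : x \in K -> a * x \in K.
Proof. by move=> Kx; apply: (rpredZ (a : R) Kx). Qed.

Lemma pi_mul (K : ideal) (a : R) (x : R^o) :
  \pi_(quotmod K) (a * x : R^o) = a *: \pi_(quotmod K) x.
Proof. exact: (pi_scale K a x). Qed.

Definition left_multiple (c x : R^o) := exists y : R^o, x = y * c.

Lemma left_multiple0 c : left_multiple c 0.
Proof. by exists 0; rewrite mul0r. Qed.

Lemma left_multiple_linear c (a : R) (x y : R^o) :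
  left_multiple c x -> left_multiple c y -> left_multiple c (a *: x + y).
Proof. by move=> [u ->] [v ->]; exists (a * u + v); rewrite mulrDl -mulrA. Qed.

Definition pideal c : ideal := submod_of (left_multiple0 c) (@left_multiple_linear c).

(** R c is a nonzero quotient of the simple module R/m.  Concretely, if y c is
    nonzero then y is not in m, so 1 = z y + n with n in m, and c = z (y c). *)
Lemma pideal_simple (m : ideal) (c : R^o) :
  maximal_ideal m -> (forall n : R^o, n \in m -> n * c = 0) -> c != 0 ->
  simple_submod (pideal c).
Proof.
move=> [m1 mmax] mc c0; split.
  by exists c => //; apply/submod_ofP; exists 1; rewrite mul1r.
move=> K Kc; have [K0|] := pselect (forall x, x \in K -> x = 0); first by left.
move=> /existsNP[x /not_implyP[Kx /eqP x0]]; right.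
have /submod_ofP[y xE] := Kc _ Kx.
have my : y \notin m by apply: contra x0 => /mc y0; rewrite xE y0.
have [z [n [mn oneE]]] := mmax _ my.
have cE : c = z * x by rewrite xE mulrA -[LHS]mul1r oneE mulrDl (mc n) ?addr0.
by move=> w /submod_ofP[v ->]; rewrite cE !idealM.
Qed.

(** * Consequences of the equality of the two classes *)

Hypothesis classes_agree : forall (sigma : preradical R) (M : lmodType R),
  cofirst_class sigma M <-> second_class sigma M.

Lemma regular_nonzero (m : ideal) :
  (1 : R^o) \notin m -> ~ zero_module (R^o : lmodType R).
Proof. by move=> /negP m1 R0; apply: m1; rewrite [1]R0 rpred0. Qed.

(** Otherwise R has no torsion for the preradical spanned by the elements that m
    kills, so R is second, hence co-first; but R/m is a torsion quotient. *)
Lemma ex_annihilated (m : ideal) : (1 : R^o) \notin m ->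
  exists2 a : R^o, a != 0 & forall n : R^o, n \in m -> n * a = 0.
Proof.
move=> m1; apply: contrapT => no_a.
pose A (M : lmodType R) (x : M) := forall n : R, (n : R^o) \in m -> n *: x = 0.
have A_hom (M N : lmodType R) (f : {linear M -> N}) x : A M x -> A N (f x).
  by move=> Ax n mn; rewrite -linearZ Ax // linear0.
pose sigma := span_preradical A_hom.
have sigR0 (x : R^o) : x \in sigma R^o -> x = 0.
  move=> xs; apply/zero_submodP; apply: (span_sub _ xs) => y Ay.
  apply/zero_submodP; apply: contrapT => /eqP y0.
  by apply: no_a; exists y.
have R0 := regular_nonzero m1.
have [//|[_ []]] : cofirst_class sigma R^o.
- by apply/classes_agree; right; split=> //; left.
- by move=> tors; apply: R0 => x; apply/sigR0/tors.
apply; exists m; split; first by move/zero_quotP => /(_ 1); exact/negP.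
move=> q; rewrite -[q]reprK -[repr q]mulr1 pi_mul.
apply/rpredZ/mem_span => n mn; apply/eqP.
by rewrite -pi_mul pi_eq0 mulr1.
Qed.

(** If aR lay in every maximal left ideal, sigma(M) = RaM would satisfy the
    conclusion of Nakayama's lemma for cyclic M: R/K = Ra(R/K) forces K = R.
    Then R would be co-first, hence second, yet sigma(R) is nonzero and
    proper. *)
Lemma ex_maximal_not_containing (a : R^o) : a != 0 ->
  exists K : ideal, maximal_ideal K /\ exists r, a * r \notin K.
Proof.
move=> a0; apply: contrapT => allK.
have {}allK (K : ideal) r : maximal_ideal K -> a * r \in K.
  move=> Kmax; apply: contrapT => /negP ar.
  by apply: allK; exists K; split=> //; exists r.
pose A (M : lmodType R) (x : M) := exists y : M, x = (a : R) *: y.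
have A_hom (M N : lmodType R) (f : {linear M -> N}) x : A M x -> A N (f x).
  by move=> [y ->]; exists (f y); rewrite linearZ.
pose sigma := span_preradical A_hom.
have z1 : (1 : R^o) \notin zero_submod R^o.
  apply: contra a0 => /zero_submodP one0.
  by rewrite -[a]mulr1 one0 mulr0.
have R0 := regular_nonzero z1.
have noquot : ~ exists K : ideal,
    ~ zero_module (quotmod K) /\ torsion_class sigma (quotmod K).
  move=> [K [q0 tors]].
  have K1 : (1 : R^o) \notin K.
    apply/negP => K1; apply: q0; apply/zero_quotP => x.
    by rewrite -[x]mulr1 idealM.
  have [L Lmax KL] := ex_maximal_ideal K1.
  (* The image of L in R/K contains a(R/K), hence everything; but it misses
     the class of 1, since K is contained in the proper ideal L. *)
  pose P (q : quotmod K) := exists2 l : R^o, l \in L & q = \pi_(quotmod K) l.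
  have P0 : P 0 by exists 0; rewrite ?rpred0 ?linear0.
  have PL b p q : P p -> P q -> P (b *: p + q).
    move=> [x Lx ->] [y Ly ->]; exists (b *: x + y); first exact: submod_linear.
    by rewrite linearP.
  pose q1 : quotmod K := \pi_(quotmod K) (1 : R^o).
  have : q1 \in submod_of P0 PL.
    apply: span_sub (tors q1) => _ [q ->].
    apply/submod_ofP; exists (a * repr q); first exact: allK.
    by rewrite pi_mul reprK.
  move=> /submod_ofP[l Ll /eqP]; rewrite quotmod_pi_eq => /KL L1l.
  by case: Lmax => /negP[]; rewrite -(subrK l 1) rpredD.
have [//|[_ [sig0|tors]]] : second_class sigma R^o.
- by apply/classes_agree; right; split=> //; right.
- case/eqP: a0; apply: sig0; apply: mem_span; exists 1.
  by rewrite [RHS]mulr1.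
have [K [K1 Kmax] _] := ex_maximal_ideal z1.
case/negP: (K1); apply: (@span_sub R R^o _ K _ _ (tors 1)) => _ [y ->].
exact: allK.
Qed.

(** Writing 1 = x b + k along R = R b + K, one gets (1 - b x) b = b k in K.  If
    1 - b x were not in m, then b itself would be a multiple of b k (as
    m b = 0), hence in K.  So 1 - b x is in m and b x is not. *)
Lemma simple_not_in_maximal (m : ideal) : maximal_ideal m ->
  exists (S : ideal) (x : R^o), [/\ simple_submod S, x \in S & x \notin m].
Proof.
move=> mmax; have [m1 _] := mmax.
have [a a0 ma] := ex_annihilated m1.
have [K [[K1 Kmax] [r Kb]]] := ex_maximal_not_containing a0.
set b := a * r in Kb.
have mb n : n \in m -> n * b = 0 by move=> mn; rewrite mulrA ma ?mul0r.
clearbody b.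
have [x [k [Kk oneE]]] := Kmax _ Kb.
have bk : (1 - b * x) * b = b * k.
  have -> : k = 1 - x * b by rewrite oneE addrAC subrr add0r.
  by rewrite mulrBl mulrBr mul1r mulr1 -mulrA.
have mbx : 1 - b * x \in m.
  apply: contrapT => /negP /(mmax.2)[y [n [mn oneE']]].
  case/negP: Kb; rewrite -[b]mul1r oneE' mulrDl (mb n) // addr0 -mulrA bk.
  by rewrite !idealM.
have bxm : b * x \notin m.
  by apply: contra m1 => mbx'; rewrite -(subrK (b * x) 1) rpredD.
exists (pideal (b * x)), (b * x); split=> //; last first.
  by apply/submod_ofP; exists 1; rewrite mul1r.
apply: (pideal_simple mmax) => [n mn|]; first by rewrite mulrA mb ?mul0r.
by apply: contra bxm => /eqP->; rewrite rpred0.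
Qed.

Definition simple_sum n (x : R^o) :=
  exists (S : 'I_n -> ideal) (u : 'I_n -> R^o),
    [/\ forall i, simple_submod (S i), forall i, u i \in S i & x = \sum_i u i].

(** The elements that are finite sums of elements of simple left ideals form the
    socle; it lies in no maximal left ideal, so it contains 1. *)
Lemma one_simple_sum : exists n, simple_sum n 1.
Proof.
pose P x := exists n, simple_sum n x.
have P0 : P 0.
  exists 0%N, (fun _ => zero_submod _), (fun _ => 0).
  by split; [case|case|rewrite big_ord0].
have PL (b : R) (x y : R^o) : P x -> P y -> P (b *: x + y).
  move=> [n1 [S1 [u1 [S1s S1u ->]]]] [n2 [S2 [u2 [S2s S2u ->]]]].
  exists (n1 + n2)%N.
  exists (fun i => match split i with inl j => S1 j | inr j => S2 j end).
  exists (fun i => match split i with inl j => b *: u1 j | inr j => u2 j end).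
  split=> [i|i|].
  - by case: (split i).
  - by case: (split i) => j; [exact/rpredZ/S1u|exact: S2u].
  rewrite big_split_ord scaler_sumr /=; congr (_ + _); apply: eq_bigr => i _.
    by rewrite (unsplitK (inl i)).
  by rewrite (unsplitK (inr i)).
apply: contrapT => no1.
have P1 : (1 : R^o) \notin submod_of P0 PL by apply/negP => /submod_ofP.
have [m mmax Pm] := ex_maximal_ideal P1.
have [S [x [Ss Sx mx]]] := simple_not_in_maximal mmax.
case/negP: mx; apply: Pm; apply/submod_ofP; exists 1%N, (fun _ => S), (fun _ => x).
by split=> //; rewrite big_ord1.
Qed.

(** Take 1 = sum_i u_i with as few simple left ideals S_i as possible.  In a
    dependence relation sum_i v_i = 0 with v_j <> 0, simplicity of S_j gives
    u_j = y v_j; subtracting y times the relation from the expression of 1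
    cancels its j-th term, contradicting minimality. *)
Lemma classes_agree_semisimple : semisimple_ring R.
Proof.
have ex1 : exists n, `[< simple_sum n 1 >].
  by have [n n1] := one_simple_sum; exists n; exact/asboolP.
case: (ex_minnP ex1) => n /asboolP[S [u [Ss Su oneE]]] nmin.
exists 'I_n, S; split=> //; split=> [x|s v s_uniq Sv sum0 j js].
  exists (index_enum 'I_n), (fun i => x * u i); split=> [i|]; first exact: idealM.
  by rewrite -mulr_sumr -oneE mulr1.
apply: contrapT => /eqP vj0.
pose Kv := pideal (v j).
have [y yE] : exists y, u j = y * v j.
  have [_ /(_ Kv)[x /submod_ofP[y ->]||KS]] := Ss j.
  - exact: idealM.
  - move=> /(_ (v j)) K0; case/eqP: vj0; apply: K0.
    by apply/submod_ofP; exists 1; rewrite mul1r.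
  by have /submod_ofP := KS _ (Su j).
case: n => [|n] in S u Ss Su oneE nmin s v s_uniq Sv sum0 j js vj0 Kv y yE *.
  by case: (j).
pose w i := u i - (if i \in s then y * v i else 0).
have Sw i : w i \in S i.
  by apply: submodB; rewrite ?Su //; case: ifP; rewrite ?rpred0 // idealM.
have w1 : 1 = \sum_i w i.
  rewrite sumrB -oneE -big_mkcond -big_uniq //= -mulr_sumr sum0 mulr0.
  by rewrite subr0.
have wj : w j = 0 by rewrite /w js yE subrr.
have /nmin : `[< simple_sum n 1 >]; last by rewrite ltnn.
apply/asboolP; exists (fun i => S (lift j i)), (fun i => w (lift j i)).
by split=> //; rewrite w1 (bigD1_ord j) //= wj add0r.
Qed.
End MaximalIdeals.

(** * Modules over a semisimple ring *)

Section SemisimpleRing.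
Variable R : pzRingType.
Hypothesis ssR : semisimple_ring R.
Implicit Types (M : lmodType R) (sigma : preradical R).

Definition in_sum M (K L : submodClosed M) x :=
  exists k l, [/\ k \in K, l \in L & x = k + l].

Lemma in_sum0 M (K L : submodClosed M) : in_sum K L 0.
Proof. by exists 0, 0; rewrite !rpred0 addr0. Qed.

Lemma in_sum_linear M (K L : submodClosed M) a x y :
  in_sum K L x -> in_sum K L y -> in_sum K L (a *: x + y).
Proof.
move=> [k [l [Kk Ll ->]]] [k' [l' [Kk' Ll' ->]]].
exists (a *: k + k'), (a *: l + l'); split; try exact: submod_linear.
by rewrite scalerDr addrACA.
Qed.

Definition sum_submod M (K L : submodClosed M) : submodClosed M :=
  submod_of (in_sum0 K L) (@in_sum_linear M K L).

(** Let L be maximal with L meeting K trivially, and write 1 = sum_i u_i with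
    u_i in simple left ideals S_i.  If u_i x is not in K + L, the elements r of
    S_i with r x in K + L form a proper submodule of S_i, hence are zero; by
    maximality some a u_i x + l is a nonzero element of K, whence a u_i = 0 and
    l is a nonzero element of both K and L. *)
Lemma ex_complement M (K : submodClosed M) : exists L : submodClosed M,
  (forall x, x \in K -> x \in L -> x = 0) /\ forall x, x \in sum_submod K L.
Proof.
have [I [S [Ss [gen _]]]] := ssR.
have [s [u [Su oneE]]] := gen 1.
have [x /zero_submodP-> []//|L [_ LK Lmax]] :=
  @ex_maximal_disjoint R M (fun z => z \in K /\ z <> 0) (zero_submod M).
exists L; split=> [x Kx Lx|x].
  by apply: contrapT => x0; apply: (LK x).
pose xmul (r : R^o) : M := (r : R) *: x.
suff uxKL i : xmul (u i) \in sum_submod K L.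
  rewrite -[x]scale1r [1]oneE scaler_suml.
  by apply: rpred_sum => i _; exact: uxKL.
pose P (r : R^o) := r \in S i /\ xmul r \in sum_submod K L.
have P0 : P 0 by rewrite /P /xmul scale0r !rpred0.
have PL (a : R) (r t : R^o) : P r -> P t -> P (a *: r + t).
  move=> [Sr xr] [St xt]; split; first exact: submod_linear.
  have -> : xmul (a *: r + t) = a *: xmul r + xmul t.
    by rewrite /xmul scalerDl scalerA.
  exact: submod_linear.
have PS : {subset submod_of P0 PL <= S i} by move=> r /submod_ofP[].
have [P_eq0|SP] := (Ss i).2 _ PS; last by have /submod_ofP[] := SP _ (Su i).
apply: contrapT => /negP uxKL.
have uxL : xmul (u i) \notin L.
  apply: contra uxKL => uxL; apply/submod_ofP.
  by exists 0, (xmul (u i)); rewrite rpred0 add0r.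
have [a [l [Ll [Kal al0]]]] := Lmax _ uxL.
have xau : xmul (a *: u i) = a *: xmul (u i) by rewrite /xmul scalerA.
have au0 : a *: u i = 0.
  apply: P_eq0; apply/submod_ofP; split; first exact: rpredZ.
  apply/submod_ofP; exists (a *: xmul (u i) + l), (- l); split=> //.
    by rewrite -sub0r submodB ?rpred0.
  by rewrite addrK xau.
apply: (LK l Ll); move: Kal al0.
by rewrite -xau au0 /xmul scale0r add0r.
Qed.

(** Each class of M/K has a unique representative in a complement of K;
    uniqueness makes the choice of representatives linear. *)
Lemma ex_quotient_section M (K : submodClosed M) :
  exists f : {linear quotmod K -> M}, forall q, \pi_(quotmod K) (f q) = q.
Proof.
have [L [KL0 KL]] := ex_complement K.
have ex_l q : exists l, l \in L /\ \pi_(quotmod K) l = q.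
  have /submod_ofP[k [l [Kk Ll rE]]] := KL (repr q).
  exists l; split=> //; rewrite -[RHS]reprK; apply/eqP.
  by rewrite quotmod_pi_eq rE opprD addrCA subrr addr0 -sub0r submodB ?rpred0.
have [f fP] := choice ex_l.
have f_lin : linear f.
  move=> a p q; apply/eqP; rewrite -subr_eq0; apply/eqP/KL0.
    by rewrite -quotmod_pi_eq quotmod_piD pi_scale !(fP _).2.
  by rewrite submodB ?submod_linear ?(fP _).1.
pose F : {linear quotmod K -> M} :=
  HB.pack f (GRing.isLinear.Build R (quotmod K) M *:%R f f_lin).
by exists F => q; exact: (fP q).2.
Qed.

(** A section of M -> M/K embeds a torsion quotient M/K into sigma(M). *)
Lemma second_cofirst_of_semisimple sigma M : second sigma M -> cofirst sigma M.
Proof.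
move=> [sig0|tors]; [right|by left].
move=> [K [q0 tors]]; apply: q0 => q.
have [f fK] := ex_quotient_section K.
by rewrite -[q]fK (sig0 (f q)) ?linear0 //; apply: prerad_hom.
Qed.

(** If L is a complement of sigma(M), then M/L is the image of sigma(M). *)
Lemma cofirst_second_of_semisimple sigma M : cofirst sigma M -> second sigma M.
Proof.
move=> [tors|noquot]; [by right|left=> x sx].
apply: contrapT => x0; apply: noquot.
have [L [KL0 KL]] := ex_complement (sigma M).
exists L; split=> [/zero_quotP allL|q]; first by apply/x0/KL0.
have /submod_ofP[k [l [sk Ll rE]]] := KL (repr q).
have -> : q = \pi_(quotmod L) k.
  by apply/eqP; rewrite -[q]reprK quotmod_pi_eq rE addrC addKr.
exact: (prerad_hom \pi_(quotmod L)).
Qed.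

End SemisimpleRing.

Theorem proposition5p8 (R : pzRingType) :
  (forall (sigma : preradical R) (M : lmodType R),
     cofirst_class sigma M <-> second_class sigma M)
  <-> semisimple_ring R.
Proof.
split=> [|ssR sigma M]; first exact: classes_agree_semisimple.
split=> [[]|[]]; try by left.
  by move=> [M0 Mc]; right; split=> //; exact: cofirst_second_of_semisimple.
by move=> [M0 Ms]; right; split=> //; exact: second_cofirst_of_semisimple.
Qed.
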